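(* There is an absolute constant $C>0$ such that the following holds. Let $n\ge 2$ and let $w=(w_1,\dots,w_n)$ and $v=(v_1,\dots,v_n)$ be increasing vectors in $\mathbb{R}^n$ with $\Delta(v)>0$. Let $\pi$ be a uniformly random permutation in $S_n$. Then for any closed interval $I\subset\mathbb{R}$ of length $|I|$ and any indices $i_1,i_2\in\{1,\dots,n\}$ such that $i_1+i_2\le n$ and $w_{n-i_2}-w_{i_1}>0$, we have $$\mathbb{P}\left(w_\pi\cdot v\in I\right)\le C\left(1+\frac{|I|}{\Delta(v)\,(w_{n-i_2}-w_{i_1})}\right)\frac{1}{(i_1+i_2)\sqrt{\min(i_1,i_2)}}.$$
   Context: A vector $w\in\mathbb{R}^n$ is called increasing if $w_1\le w_2\le\dots\le w_n$ (weak inequalities). For $v\in\mathbb{R}^n$, $\Delta(v)=\min_{i\ne j}|v_i-v_j|$. For a permutation $\pi\in S_n$, $w_\pi=(w_{\pi(1)},\dots,w_{\pi(n)})$, and $w_\pi\cdot v=\sum_{i=1}^n w_{\pi(i)}v_i$. Intervals are closed and bounded, of length $|I|\ge 0$ (a single point is an interval of length $0$). *)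

(* Defs.v *)
From mathcomp Require Import all_boot all_order all_fingroup all_algebra.
From mathcomp Require Import reals.

Set Implicit Arguments.
Unset Strict Implicit.
Unset Printing Implicit Defensive.

Import Order.TTheory GRing.Theory Num.Theory.
Local Open Scope ring_scope.

Section Vectors.
Context {R : realType} {n : nat}.
Implicit Types u v w : 'rV[R]_n.

Definition increasing w : Prop :=
  forall i j : 'I_n, (i <= j)%N -> w 0 i <= w 0 j.

Definition dot u v : R := \sum_(i < n) u 0 i * v 0 i.

(* The k-th entry of w counted from 1, i.e. w_k = w 0 (k - 1) for 1 <= k <= n;
   the value is 0 outside this range. *)
Definition entry1 w (k : nat) : R := (0 :: [seq w 0 i | i : 'I_n])`_k.

Definition gaps v : seq R :=
  [seq `|v 0 p.1 - v 0 p.2| | p in [pred p : 'I_n * 'I_n | p.1 != p.2]].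

(* The minimum of the list of gaps, which is nonempty for n >= 2; the starting
   value of the iterated minimum is itself an item of that list. *)
Definition Delta v : R := \big[Num.min/head 0 (gaps v)]_(x <- gaps v) x.

End Vectors.

Definition uniform_probability (R : realType) (T : finType) (E : {set T}) : R :=
  #|E|%:R / #|T|%:R.

(* Main.v *)
Require Import Defs.
From mathcomp Require Import all_boot all_order all_fingroup all_algebra.
From mathcomp Require Import reals.
From mathcomp Require Import zify ring lra.

Set Implicit Arguments.
Unset Strict Implicit.
Unset Printing Implicit Defensive.

Import Order.TTheory GRing.Theory Num.Theory.

(** The entries of [w] at the first [i1] and the last [i2] indices differ by at
    least [delta := w_(n-i2) - w_(i1)].  Revealing the positions of all other
    entries only shifts the interval, so the vector may be assumed to consist
    of [i1] low and [i2] high entries, [N = i1 + i2] in total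
    ([outer_blocks_bound]).  Reveal further in which order the low entries
    occur, and in which order the high ones do: what remains random is the set
    [x] of positions of the high entries, a uniform set of fixed size
    ([count_perms]).  Moving a high entry up past a neighbouring low one raises
    the sum by at least [Delta v * delta]; hence the sum is, after scaling, a
    function [F] on sets that grows by at least 1 whenever an element of the set
    is exchanged for a larger one ([exchange_increasing]).  Cutting the interval
    into unit pieces, it remains to bound a family [A] of [k]-sets, [2k <= N],
    on which [F] varies by less than 1: [narrow_bound] gives
    [|A| <= 162 C(N, k) / (N sqrt k)].

    Such a family is an antichain for upward exchanges, and it is counted by an
    averaging argument over long chains.  Cut the positions into a lower, a
    middle and an upper region, the outer two of equal size [b] about [N / 3].
    Fix [q - 1] middle elements.  A chain then alternates between two kinds of
    moves: one extra element [y] sweeps through the middle region, and after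
    each sweep [y] leaves for the upper region while a new element comes in from
    the lower one.  Its members have [q] middle elements and [t] upper ones, for
    each [t] with about [N / 3 - q] choices of [y], and at most one member lies
    in [A].  Averaging over all permutations preserving the three regions, which
    act transitively on sets with given numbers of elements in the regions, gives
    an inequality of LYM type.  As no single [t] accounts for more than a
    fraction [O(1 / sqrt (s + 1))] of the sets with [s = k - q] outer elements
    ([hypergeom_upper]), this bounds the members of [A] with [q] middle elements
    ([middle_bound_sqr]).  The sweeps contribute the factor [1 / N] and the
    alternation the factor [1 / sqrt k].

    Summing over [q] needs the mean of [1 / (q sqrt (s + 1))] for a
    hypergeometric [q - 1], which is of the order of [1 / (k sqrt k)].  Linearizing
    the square root by the inequality of arithmetic and geometric means
    ([ler_amgm]) turns it into means of [1 / q] and [1 / (q (s + 1))]; these are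
    exact Vandermonde sums, because dividing a binomial coefficient by [q] only
    shifts its indices. *)

(** * Binomial estimates *)

Lemma mul_central_bin b :
  b.+1 * 'C(b.+1.*2, b.+1) = 2 * b.*2.+1 * 'C(b.*2, b).
Proof.
have e1 := mul_bin_diag b.+1.*2 b; have e2 := mul_bin_down b.*2.+1 b.
rewrite doubleS !succnK in e1 e2 *.
have -> : 2 * b.*2.+1 * 'C(b.*2, b) = 2 * (b.*2.+1 * 'C(b.*2, b)) by rewrite mulnA.
rewrite e2 -e1 -addnn mulnA; congr (_ * _); lia.
Qed.

Lemma central_bin_upper b : b.*2.+1 * 'C(b.*2, b) ^ 2 <= 16 ^ b.
Proof.
elim: b => // b IHb.
rewrite -(@leq_pmul2l (b.+1 ^ 2)) ?expn_gt0 //.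
rewrite mulnCA -expnMn mul_central_bin expnMn.
apply: (@leq_trans (4 * b.*2.+1 * b.*2.+3 * 16 ^ b)).
  apply: leq_trans (leq_mul (leqnn (4 * b.*2.+1 * b.*2.+3)) IHb).
  by apply: eq_leq; rewrite doubleS; ring.
rewrite [16 ^ b.+1]expnS mulnA leq_mul2r; apply/orP; right.
rewrite -!addnn; nia.
Qed.

Lemma central_bin_lower b : 16 ^ b <= (4 * b + 1) * 'C(b.*2, b) ^ 2.
Proof.
elim: b => // b IHb.
rewrite -(@leq_pmul2l ((4 * b + 1) * b.+1 ^ 2)); last by rewrite muln_gt0 expn_gt0 addn1.
apply: (@leq_trans (16 * b.+1 ^ 2 * (4 * b + 1) * ((4 * b + 1) * 'C(b.*2, b) ^ 2))).
  apply: leq_trans (leq_mul (leqnn (16 * b.+1 ^ 2 * (4 * b + 1))) IHb).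
  by apply: eq_leq; rewrite [16 ^ b.+1]expnS; ring.
have -> : (4 * b + 1) * b.+1 ^ 2 * ((4 * b.+1 + 1) * 'C(b.+1.*2, b.+1) ^ 2)
   = (4 * b + 1) * (4 * b.+1 + 1) * (b.+1 * 'C(b.+1.*2, b.+1)) ^ 2 by ring.
rewrite mul_central_bin !expnMn.
have -> : 16 * b.+1 ^ 2 * (4 * b + 1) * ((4 * b + 1) * 'C(b.*2, b) ^ 2)
   = (4 * b + 1) * (16 * b.+1 ^ 2 * (4 * b + 1) * 'C(b.*2, b) ^ 2) by ring.
rewrite -[leqRHS]mulnA leq_mul2l; apply/orP; right.
rewrite mulnA leq_mul2r; apply/orP; right.
rewrite -!addnn; nia.
Qed.

(** The ratio of consecutive coefficients, given by
    [(t + 1) C(2m, t + 1) = (2m - t) C(2m, t)], passes 1 at [t = m]. *)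
Lemma bin_le_central m t : 'C(m.*2, t) <= 'C(m.*2, m).
Proof.
suff below d : d <= m -> 'C(m.*2, m - d) <= 'C(m.*2, m).
  have [t_le|t_gt] := leqP t m; first by rewrite -(subKn t_le) below ?leq_subr.
  have [t_le2|t_gt2] := leqP t m.*2; last by rewrite bin_small.
  rewrite -bin_sub // (_ : m.*2 - t = m - (t - m)); last by lia.
  by rewrite below //; lia.
elim: d => [|d IHd] d_lt; first by rewrite subn0.
apply: leq_trans (IHd (ltnW d_lt)).
have := mul_bin_left m.*2 (m - d.+1).
rewrite (_ : (m - d.+1).+1 = m - d); last by lia.
move=> e; rewrite -(@leq_pmul2l (m - d)) ?subn_gt0 // e leq_mul2r.
by apply/orP; right; lia.
Qed.

Lemma bin_sqr_upper s t : s.+1 * 'C(s, t) ^ 2 <= 2 * 4 ^ s.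
Proof.
pose m := s./2; have s_eq : s = odd s + m.*2 by rewrite odd_double_half.
have upper := central_bin_upper m.
have step : 'C(s, t) <= 2 ^ odd s * 'C(m.*2, m).
  rewrite {1}s_eq; case: (odd s); last by rewrite add0n expn0 mul1n bin_le_central.
  rewrite add1n expn1 mul2n -[leqRHS]addnn; case: t => [|t].
    by rewrite bin0 addn_gt0 bin_gt0 -addnn leq_addr.
  by rewrite binS leq_add // bin_le_central.
have -> : 4 ^ s = 4 ^ odd s * 16 ^ m.
  by rewrite {1}s_eq expnD -[in 4 ^ m.*2]mul2n expnM.
move: step; rewrite -(leq_exp2r _ _ (ltn0Sn 1)) expnMn => step.
apply: leq_trans (leq_mul (leqnn s.+1) step) _.
apply: (@leq_trans (2 * (4 ^ odd s * (m.*2.+1 * 'C(m.*2, m) ^ 2)))); last first.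
  by rewrite !leq_mul2l upper !orbT.
rewrite -expnM mulnC (mulnC _ 2) (expnM 2 2 (odd s)).
rewrite -mulnA (mulnCA 2) leq_mul2l; apply/orP; right.
rewrite mulnCA mulnC mulnA leq_mul2r; apply/orP; right.
by rewrite {1}s_eq; case: (odd s) => /=; lia.
Qed.

(** Both sides count the ways to choose a half of a [2b]-set and to mark [s] of
    its elements, [t] of them in the chosen half.  The right-hand side splits the
    hypergeometric weight into two binomial ones of independent sizes. *)
Lemma hypergeom_eq b s t : t <= s -> t <= b -> s - t <= b ->
  'C(b, t) * 'C(b, s - t) * 'C(b.*2, b) = 'C(b.*2, s) * 'C(s, t) * 'C(b.*2 - s, b - t).
Proof.
move=> le_ts le_tb le_stb.
have f1 := bin_fact le_tb; have f2 := bin_fact le_stb.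
have le_b2b : b <= b.*2 by lia.
have le_s2b : s <= b.*2 by lia.
have le_bt : b - t <= b.*2 - s by lia.
have f3 := bin_fact le_b2b; have f4 := bin_fact le_s2b.
have f5 := bin_fact le_ts; have f6 := bin_fact le_bt.
rewrite (_ : b.*2 - s - (b - t) = b - (s - t)) in f6; last by lia.
rewrite (_ : b.*2 - b = b) in f3; last by lia.
have pos : 0 < t`! * (b - t)`! * (s - t)`! * (b - (s - t))`! by rewrite !muln_gt0 !fact_gt0.
apply/eqP; rewrite -(eqn_pmul2r pos); apply/eqP.
transitivity (b.*2)`!.
  rewrite -f3 -{1}f1 -f2; ring.
rewrite -f4 -f5 -f6; ring.
Qed.

(** By [hypergeom_eq] the probability of [t] is a product of two binomial
    probabilities, of sizes [s] and [2b - s], divided by a central one of size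
    [2b].  The last hypothesis keeps [2b - s] of the order of [b], so that the
    second factor compensates the divisor. *)
Lemma hypergeom_upper b s t : t <= s -> t <= b -> s - t <= b ->
    b.+1 <= 2 * (b.*2 - s).+1 ->
  s.+1 * ('C(b, t) * 'C(b, s - t)) ^ 2 <= 32 * 'C(b.*2, s) ^ 2.
Proof.
move=> le_ts le_tb le_stb le_sb.
have le_s2b : s <= b.*2 by lia.
have e := hypergeom_eq le_ts le_tb le_stb.
set r := b.*2 - s in le_sb e *.
have lo := central_bin_lower b.
have u1 := bin_sqr_upper s t; have u2 := bin_sqr_upper r (b - t).
have pos : 0 < r.+1 * 16 ^ b by rewrite muln_gt0 expn_gt0.
rewrite -(leq_pmul2l pos).
have p16 : 4 ^ s * 4 ^ r = 16 ^ b.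
  by rewrite -expnD subnKC // -mul2n expnM.
apply: (@leq_trans (r.+1 * s.+1 * (4 * b + 1) * ('C(b, t) * 'C(b, s - t) * 'C(b.*2, b)) ^ 2)).
  have := leq_mul (leqnn (r.+1 * s.+1 * ('C(b, t) * 'C(b, s - t)) ^ 2)) lo.
  by congr (_ <= _); ring.
rewrite e; apply: (@leq_trans ((4 * b + 1) * 'C(b.*2, s) ^ 2 * (2 * 4 ^ s * (2 * 4 ^ r)))).
  have := leq_mul (leqnn ((4 * b + 1) * 'C(b.*2, s) ^ 2)) (leq_mul u1 u2).
  by congr (_ <= _); ring.
have -> : (4 * b + 1) * 'C(b.*2, s) ^ 2 * (2 * 4 ^ s * (2 * 4 ^ r))
  = (4 * (4 * b + 1)) * (16 ^ b * 'C(b.*2, s) ^ 2) by rewrite -p16; ring.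
have -> : r.+1 * 16 ^ b * (32 * 'C(b.*2, s) ^ 2)
  = (32 * r.+1) * (16 ^ b * 'C(b.*2, s) ^ 2) by ring.
by rewrite leq_mul2r; apply/orP; right; lia.
Qed.

(** * Permutations preserving a partition into regions *)

Lemma exists_colour_perm (C : eqType) n (c c' : 'I_n -> C) :
    (forall e, #|[set i | c i == e]| = #|[set i | c' i == e]|) ->
  exists g : 'S_n, forall i, c' (g i) = c i.
Proof.
move=> eq_count.
have countE (d : 'I_n -> C) e : count_mem e [tuple d i | i < n] = #|[set i | d i == e]|.
  by rewrite /= count_map cardsE cardE size_filter enumT.
have : perm_eq [tuple c i | i < n] [tuple c' i | i < n].
  by apply/allP => e _ /=; rewrite !countE eq_count.
case/tuple_permP => g /val_inj eq_g; exists g => i.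
by have := congr1 (fun s => tnth s i) eq_g; rewrite !tnth_mktuple.
Qed.

Section RegionPermutations.
Variables (C : finType) (n : nat) (reg : 'I_n -> C).

Definition region_perms := [set g : 'S_n | [forall i, reg (g i) == reg i]].

Definition profile (x : {set 'I_n}) := [ffun e => #|[set i in x | reg i == e]|].

Lemma region_permP (g : 'S_n) : reflect (forall i, reg (g i) = reg i) (g \in region_perms).
Proof. by rewrite inE; apply: (iffP forallP) => h i; apply/eqP. Qed.

Lemma region_permsM g h : g \in region_perms -> (g * h \in region_perms)%g = (h \in region_perms).
Proof.
move/region_permP=> gP; apply/region_permP/region_permP => hP i.
  by have := hP ((g^-1)%g i); rewrite permM -[RHS]gP permKV.
by rewrite permM hP gP.
Qed.

Lemma profile_imset g (x : {set 'I_n}) : g \in region_perms -> profile (g @: x) = profile x.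
Proof.
move/region_permP=> gP; apply/ffunP => e; rewrite !ffunE.
rewrite -(card_imset [set i in x | reg i == e] (@perm_inj _ g)); congr #|pred_of_set _|.
apply/setP => i; rewrite inE; apply/andP/imsetP => [[/imsetP[j jx ->]]|[j]].
  by rewrite gP => rj; exists j; rewrite ?inE ?jx.
by rewrite inE => /andP[jx rj] ->; rewrite gP imset_f.
Qed.

Lemma profile_trans (x y : {set 'I_n}) : profile x = profile y ->
  exists2 g, g \in region_perms & g @: x = y.
Proof.
move=> xy.
have [|g gP] := @exists_colour_perm _ n (fun i => (reg i, i \in x)) (fun i => (reg i, i \in y)).
  have split_reg (z : {set 'I_n}) e : #|[set i | reg i == e]| =
      #|[set i | (reg i, i \in z) == (e, true)]| + #|[set i | (reg i, i \in z) == (e, false)]|.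
    rewrite -(cardsID z [set i | reg i == e]); congr (_ + _); apply: eq_card => i;
    by rewrite !inE xpair_eqE; case: (i \in z); rewrite ?andbT ?andbF.
  have in_z (z : {set 'I_n}) e : #|[set i | (reg i, i \in z) == (e, true)]| = profile z e.
    by rewrite ffunE; apply: eq_card => i; rewrite !inE xpair_eqE eqb_id andbC.
  case=> e [|]; first by rewrite !in_z xy.
  have := split_reg x e; rewrite (split_reg y e) !in_z xy => /eqP.
  by rewrite eqn_add2l => /eqP.
exists g; first by apply/region_permP => i; have [] := gP i.
apply/setP => i; rewrite -[i](permKV g) mem_imset; last exact: perm_inj.
by have [_ ->] := gP ((g^-1)%g i).
Qed.

(** Region-preserving permutations act transitively on the sets of a given
    profile, so each of these sets is [g @: x] for equally many [g]. *)
Lemma region_average (x : {set 'I_n}) (A : {set {set 'I_n}}) :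
  #|[set y | profile y == profile x]| * #|[set g in region_perms | g @: x \in A]| =
  #|region_perms| * #|A :&: [set y | profile y == profile x]|.
Proof.
set O := [set y | _]; pose z := #|[set g in region_perms | g @: x == x]|.
have fiber y : y \in O -> #|[set g in region_perms | g @: x == y]| = z.
  rewrite inE => /eqP/esym/profile_trans[h hG hx].
  rewrite /z -[RHS](card_imset _ (mulIg h)); congr #|pred_of_set _|; apply/setP => g.
  rewrite [LHS]inE; apply/andP/imsetP => [[gG /eqP gx]|[k]].
    exists (g * h^-1)%g; last by rewrite mulgKV.
    have hVG : (h^-1)%g \in region_perms.
      by rewrite -(region_permsM _ hG) mulgV; apply/region_permP => i; rewrite perm1.
    rewrite inE region_permsM // hVG; apply/eqP.
    rewrite (eq_imset _ (g := (h^-1)%g \o g)); last by move=> i; rewrite permM.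
    rewrite imset_comp gx -hx -imset_comp -[RHS]imset_id.
    by apply: eq_imset => i /=; rewrite permK.
  rewrite inE => /andP[kG /eqP kx] ->; rewrite region_permsM // hG; split=> //.
  rewrite (eq_imset _ (g := h \o k)); last by move=> i; rewrite permM.
  by rewrite imset_comp kx hx.
have count (B : {set {set 'I_n}}) : #|[set g in region_perms | g @: x \in B]| = #|B :&: O| * z.
  rewrite -sum1_card (partition_big (fun g : 'S_n => g @: x) (mem (B :&: O))) /=.
    rewrite -sum_nat_const; apply: eq_bigr => y; rewrite inE => /andP[yB yO].
    rewrite -(fiber y yO) -sum1_card; apply: eq_bigl => g; rewrite !inE.
    by case: eqP => [->|]; rewrite ?yB ?andbT ?andbF.
  by move=> g; rewrite inE => /andP[gG gB]; rewrite /= in_setI gB inE profile_imset ?eqxx.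
have G_card : #|region_perms| = #|O| * z.
  have := count setT; rewrite setTI => <-.
  by congr #|pred_of_set _|; apply/setP => g; rewrite [RHS]inE in_setT andbT.
by rewrite count G_card mulnA mulnAC.
Qed.

End RegionPermutations.

(** * Chains of upward exchanges *)

Section Exchange.
Variables (R : realDomainType) (n k : nat) (F : {set 'I_n} -> R).
Local Open Scope ring_scope.

(** The unit increment fixes the scale: it makes the number of unit intervals
    needed to cover a range of values a bound on the number of antichains. *)
Definition exchange_increasing := forall (x : {set 'I_n}) (i j : 'I_n),
  #|x| = k -> i \in x -> j \notin x -> (i < j)%N -> F x + 1 <= F (j |: x :\ i).

(** Such a family is an antichain when [F] is [exchange_increasing], and only
    the comparison of values of [F] is used to express this. *)
Definition narrow (A : {set {set 'I_n}}) :=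
  (forall x, x \in A -> #|x| = k) /\ (forall x y, x \in A -> y \in A -> F y < F x + 1).

End Exchange.

Lemma card_exchange n (x : {set 'I_n}) (i j : 'I_n) :
  i \in x -> j \notin x -> #|j |: x :\ i| = #|x|.
Proof.
move=> ix jx; by rewrite cardsU1 in_setD1 (negPf jx) andbF [RHS](cardsD1 i) ix.
Qed.

Lemma card_ord_interval n lo hi : hi <= n -> #|[set i : 'I_n | lo <= i < hi]| = hi - lo.
Proof.
move=> le_hi; rewrite cardsE -sum1_card -(big_mkord (fun i => lo <= i < hi) (fun=> 1)).
rewrite -[RHS]muln1 -sum_nat_const_nat.
rewrite (big_nat_widenl lo 0) // (big_nat_widen 0 hi n _ _ le_hi).
by apply: eq_bigl => i; rewrite /=.
Qed.

Section Chains.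
Variables (R : realDomainType) (n k b : nat) (F : {set 'I_n} -> R) (A : {set {set 'I_n}}).
Hypotheses (le_2bn : b.*2 <= n) (F_exch : exchange_increasing k F) (A_narrow : narrow k F A).

Let Low := [set i : 'I_n | i < b].
Let Mid := [set i : 'I_n | b <= i < n - b].
Let Up := [set i : 'I_n | n - b <= i].
Let region (i : 'I_n) := (b <= i, n - b <= i).

Lemma card_Low : #|Low| = b.
Proof.
rewrite -[RHS]subn0 -(@card_ord_interval n 0 b); last by lia.
by apply: eq_card => i; rewrite !inE.
Qed.

Lemma card_Mid : #|Mid| = n - b.*2.
Proof. by rewrite card_ord_interval; lia. Qed.

Lemma card_Up : #|Up| = b.
Proof.
have -> : Up = [set i : 'I_n | n - b <= i < n].
  by apply/setP => i; rewrite !inE ltn_ord andbT.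
by rewrite card_ord_interval; lia.
Qed.

Lemma exchange_perm (g : 'S_n) (x : {set 'I_n}) (i j : 'I_n) :
    #|x| = k -> i \in x -> j \notin x -> g i < g j ->
  (F (g @: x) + 1 <= F (g @: (j |: x :\ i)))%R.
Proof.
move=> xk ix jx lt_ij.
rewrite (_ : g @: (j |: x :\ i) = g j |: (g @: x) :\ g i).
  by apply: F_exch; rewrite ?card_imset ?mem_imset //; apply: perm_inj.
apply/setP => e; rewrite -[e](permKV g) !inE !mem_imset; try exact: perm_inj.
by rewrite !inE !(inj_eq perm_inj).
Qed.

Lemma card_regions (x : {set 'I_n}) : #|x| = #|x :&: Low| + #|x :&: Mid| + #|x :&: Up|.
Proof.
rewrite -(cardsID Low x) -addnA; congr (_ + _).
rewrite -(cardsID Mid (x :\: Low)); congr (_ + _); apply: eq_card => i; rewrite !inE;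
by case: (i \in x); lia.
Qed.

Lemma profile_regions (x y : {set 'I_n}) : #|x| = #|y| -> #|x :&: Mid| = #|y :&: Mid| ->
  #|x :&: Up| = #|y :&: Up| -> profile region x = profile region y.
Proof.
move=> xy xyM xyU.
have xyL : #|x :&: Low| = #|y :&: Low|.
  by move: xy; rewrite (card_regions x) (card_regions y) xyM xyU => /addIn/addIn.
apply/ffunP => -[[] []]; rewrite !ffunE.
- have E (z : {set 'I_n}) : [set i in z | region i == (true, true)] = z :&: Up.
    by apply/setP => i; rewrite !inE xpair_eqE; case: (i \in z); lia.
  by rewrite !E.
- have E (z : {set 'I_n}) : [set i in z | region i == (true, false)] = z :&: Mid.
    by apply/setP => i; rewrite !inE xpair_eqE; case: (i \in z); lia.
  by rewrite !E.
- have E (z : {set 'I_n}) : [set i in z | region i == (false, true)] = set0.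
    by apply/setP => i; rewrite !inE xpair_eqE; case: (i \in z); lia.
  by rewrite !E.
- have E (z : {set 'I_n}) : [set i in z | region i == (false, false)] = z :&: Low.
    by apply/setP => i; rewrite !inE xpair_eqE; case: (i \in z); lia.
  by rewrite !E.
Qed.

Variables (s q : nat).
Hypotheses (k_eq : k = s + q) (q_gt0 : 0 < q).

(** For [p = (t, y)]: the sweeping element [y], a fixed block of [q - 1] middle
    elements below it, and [s] outer elements, namely the first
    [s - t] lower and the first [t] upper positions; [s + q = k] in total. *)
Definition chain (p : 'I_s.+1 * 'I_n) : {set 'I_n} :=
  [set i : 'I_n | [|| i < s - p.1, b <= i < b + q.-1, i == p.2 | n - b <= i < n - b + p.1]].

Definition chain_index :=
  [set p : 'I_s.+1 * 'I_n | (s - p.1 <= b) && (p.1 <= b) && (b + q.-1 <= p.2 < n - b)].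

Lemma chain_regions p : p \in chain_index ->
  [/\ #|chain p :&: Low| = s - p.1, #|chain p :&: Mid| = q & #|chain p :&: Up| = p.1].
Proof.
case: p => t y; rewrite inE /= => /andP[/andP[sb tb] /andP[y1 y2]]; split.
- rewrite -[RHS]subn0 -(@card_ord_interval n 0 (s - t)); last by lia.
  by apply: eq_card => i; rewrite !inE -val_eqE /=; lia.
- rewrite (_ : _ :&: _ = y |: [set i : 'I_n | b <= i < b + q.-1]).
    rewrite cardsU1 card_ord_interval ?inE; last by lia.
    by lia.
  by apply/setP => i; rewrite !inE -val_eqE /=; lia.
- rewrite (_ : _ :&: _ = [set i : 'I_n | n - b <= i < n - b + t]).
    by rewrite card_ord_interval; lia.
  by apply/setP => i; rewrite !inE -val_eqE /=; lia.
Qed.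

Lemma card_chain p : p \in chain_index -> #|chain p| = k.
Proof.
move=> pJ; have [cL cM cU] := chain_regions pJ.
by rewrite card_regions cL cM cU k_eq; have := ltn_ord p.1; lia.
Qed.

Lemma chain_slide (g : 'S_n) t y y' : (t, y) \in chain_index -> (t, y') \in chain_index ->
  g y < g y' -> (F (g @: chain (t, y)) + 1 <= F (g @: chain (t, y')))%R.
Proof.
move=> yJ y'J lt_yy'; have := yJ; have := y'J; rewrite !inE /= => y'P yP.
have neq : y != y' by apply: contraTneq lt_yy' => ->; rewrite ltnn.
rewrite (_ : chain (t, y') = y' |: chain (t, y) :\ y); last first.
  by apply/setP => i; rewrite !inE /=; move: neq; rewrite -!val_eqE /=; lia.
apply: exchange_perm; rewrite ?card_chain // !inE /= ?eqxx ?orbT //.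
by move: neq; rewrite -!val_eqE /=; lia.
Qed.

(** Going from [t] to [t + 1] takes two upward exchanges: [y] moves on to the
    next free upper position, then the last lower element moves to [y'].
    Doing them in this order allows [y = y'], and each goes from one region to a
    higher one, so that [g] cannot reverse it. *)
Lemma chain_climb (g : 'S_n) (t t' : 'I_s.+1) y y' : g \in region_perms region -> t' = t.+1 :> nat ->
    (t, y) \in chain_index -> (t', y') \in chain_index ->
  (F (g @: chain (t, y)) + 1 <= F (g @: chain (t', y')))%R.
Proof.
move=> /region_permP gP tt' yJ y'J; have := yJ; have := y'J; rewrite !inE /= => y'P yP.
have g_region i : ((b <= g i) = (b <= i)) * ((n - b <= g i) = (n - b <= i)).
  by have [-> ->] := gP i.
have u_lt : n - b + t < n by lia.
have a_lt : s - t.+1 < n by lia.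
have ts := ltn_ord t'.
pose u := Ordinal u_lt; pose a := Ordinal a_lt.
have card_yJ := card_chain yJ.
have y_in : y \in chain (t, y) by rewrite !inE eqxx !orbT.
have u_notin : u \notin chain (t, y) by rewrite !inE -!val_eqE /=; lia.
have gyu : g y < g u.
  have [_ gu] := g_region u; have [_ gy] := g_region y.
  by move: gu gy; rewrite /u /=; lia.
have step1 := exchange_perm card_yJ y_in u_notin gyu.
have a_in : a \in u |: chain (t, y) :\ y by rewrite !inE -!val_eqE /=; lia.
have y'_notin : y' \notin u |: chain (t, y) :\ y by rewrite !inE -!val_eqE /=; lia.
have gay' : g a < g y'.
  have [ga _] := g_region a; have [gy' _] := g_region y'.
  by move: ga gy'; rewrite /a /=; lia.
have card1 : #|u |: chain (t, y) :\ y| = k by rewrite card_exchange.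
have step2 := exchange_perm card1 a_in y'_notin gay'.
rewrite (_ : chain (t', y') = y' |: (u |: chain (t, y) :\ y) :\ a).
  by apply: le_trans step2; rewrite ler_wpDr // (le_trans _ step1) // ler_wpDr.
by apply/setP => i; rewrite !inE -!val_eqE /=; lia.
Qed.

Lemma chain_rises (g : 'S_n) (t t' : 'I_s.+1) y y' : g \in region_perms region -> t < t' ->
    (t, y) \in chain_index -> (t', y') \in chain_index ->
  (F (g @: chain (t, y)) + 1 <= F (g @: chain (t', y')))%R.
Proof.
move=> gG lt_tt' yJ; move: lt_tt'.
have [d] := ubnP (t' - t); elim: d => // d IHd in t' y' * => lt_d lt_tt' y'J.
have [tt'|tt'] := eqVneq (t' : nat) t.+1; first exact: chain_climb.
have lt_s : t'.-1 < s.+1 by have := ltn_ord t'; lia.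
have midJ : (Ordinal lt_s, y) \in chain_index.
  by move: yJ y'J; rewrite !inE /=; lia.
have := IHd (Ordinal lt_s) y _ _ midJ; rewrite /= => /(_ _ _)/le_trans-> //; try lia.
rewrite -[leLHS]addr0; apply: le_trans (chain_climb gG _ midJ y'J); last by move=> /=; lia.
by rewrite lerD2l.
Qed.

(** For equal [t] the two members differ by one exchange, whose direction
    depends on how [g] orders the middle region; for different [t] they are
    ordered by [chain_rises]. *)
Lemma chain_meets_once (g : 'S_n) : g \in region_perms region ->
  #|[set p in chain_index | g @: chain p \in A]| <= 1.
Proof.
move=> gG; have [_ A_lt] := A_narrow.
suff main p p' : p \in chain_index -> p' \in chain_index -> g @: chain p \in A ->
    g @: chain p' \in A -> p.1 <= p'.1 -> p = p'.
  apply/card_le1_eqP => p p' /setIdP[pJ pA] /setIdP[p'J p'A].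
  case/orP: (leq_total p.1 p'.1) => le_pp'; first exact/esym/main.
  exact: main.
case: p p' => [t y] [t' y'] pJ p'J pA p'A /=; rewrite leq_eqVlt => /orP[/eqP/val_inj tt'|lt_tt'].
  subst t'; have [gyy'|neq] := eqVneq (g y : nat) (g y').
    by rewrite (perm_inj (val_inj gyy')).
  have [lt|lt|eq] := ltngtP (g y) (g y'); last by rewrite eq eqxx in neq.
    by have := chain_slide pJ p'J lt; rewrite leNgt A_lt.
  by have := chain_slide p'J pJ lt; rewrite leNgt A_lt.
by have := chain_rises gG lt_tt' pJ p'J; rewrite leNgt A_lt.
Qed.

Lemma card_profile_chain p : p \in chain_index ->
  #|[set x | profile region x == profile region (chain p)]|
    <= 'C(b, s - p.1) * 'C(n - b.*2, q) * 'C(b, p.1).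
Proof.
move=> pJ; have [cL cM cU] := chain_regions pJ.
have region_card (x : {set 'I_n}) (e : bool * bool) : profile region x = profile region (chain p) ->
   #|[set i in x | region i == e]| = #|[set i in chain p | region i == e]|.
  by move/ffunP/(_ e); rewrite !ffunE.
pose draws (B : {set 'I_n}) j := [set C : {set 'I_n} | C \subset B & #|C| == j].
pose parts (x : {set 'I_n}) := (x :&: Low, x :&: Mid, x :&: Up).
have parts_inj : injective parts.
  move=> x y [eL eM eU]; apply/setP => i.
  move/setP/(_ i): eL; move/setP/(_ i): eM; move/setP/(_ i): eU; rewrite !inE.
  by case: (i \in x); case: (i \in y); lia.
rewrite -(card_imset _ parts_inj).
apply: leq_trans (subset_leq_card (_ : _ \subset
  setX (setX (draws Low (s - p.1)) (draws Mid q)) (draws Up p.1))) _; last first.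
  by rewrite !cardsX !cards_draws card_Low card_Mid card_Up.
apply/subsetP => _ /imsetP[x xO ->].
have {xO} : profile region x = profile region (chain p) by apply/eqP; rewrite inE in xO.
move/region_card=> eq_card_x.
have setL (z : {set 'I_n}) : z :&: Low = [set i in z | region i == (false, false)].
  by apply/setP => i; rewrite !inE xpair_eqE; case: (i \in z); lia.
have setM (z : {set 'I_n}) : z :&: Mid = [set i in z | region i == (true, false)].
  by apply/setP => i; rewrite !inE xpair_eqE; case: (i \in z); lia.
have setU (z : {set 'I_n}) : z :&: Up = [set i in z | region i == (true, true)].
  by apply/setP => i; rewrite !inE xpair_eqE; case: (i \in z); lia.
rewrite !in_setX /= 3!in_set !subsetIr /= setL setM setU !eq_card_x.
by rewrite -setL -setM -setU cL cM cU !eqxx.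
Qed.

(** Double counting of the pairs of a region-preserving [g] and a chain index
    [p] with [g @: chain p \in A].  There is at most one [p] for each [g]; for
    each [p] the fraction of such [g] is, by [region_average], the density of [A]
    among the sets with the profile of [chain p], and there are [X] of these at
    most. *)
Lemma middle_bound X :
    (forall t, t <= s -> t <= b -> s - t <= b ->
       'C(b, s - t) * 'C(n - b.*2, q) * 'C(b, t) <= X) ->
  (n - b.*2 - q.-1) * #|[set x in A | #|x :&: Mid| == q]| <= X.
Proof.
move=> X_max; have [A_card _] := A_narrow.
set Aq := [set x in A | _]; pose G := region_perms region.
pose O p := [set x | profile region x == profile region (chain p)].
have G_gt0 : 0 < #|G|.
  by apply/card_gt0P; exists 1%g; apply/region_permP => i; rewrite perm1.
have upper : \sum_(p in chain_index) #|[set g in G | g @: chain p \in A]| <= #|G|.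
  apply: (@leq_trans (\sum_(g in G) #|[set p in chain_index | g @: chain p \in A]|)).
    rewrite (eq_bigr (fun p => \sum_(g in G) (g @: chain p \in A))); last first.
      by move=> p _; rewrite -sum1dep_card big_mkcondr.
    rewrite exchange_big; apply: leq_sum => g _.
    by rewrite -[leqRHS]sum1dep_card [leqRHS]big_mkcondr.
  by rewrite -[leqRHS]sum1_card; apply: leq_sum => g gG; apply: chain_meets_once.
have lower : \sum_(p in chain_index) #|A :&: O p| <= X.
  rewrite -(leq_pmul2l G_gt0) big_distrr /=.
  apply: leq_trans (leq_mul upper (leqnn X)).
  rewrite big_distrl /=; apply: leq_sum => p pJ; rewrite -region_average mulnC.
  rewrite leq_mul2l; apply/orP; right.
  apply: leq_trans (card_profile_chain pJ) _.
  by move: pJ; rewrite inE => /andP[/andP[sp pb] _]; apply: X_max; rewrite // -ltnS.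
apply: leq_trans lower.
have valid (x : {set 'I_n}) : x \in Aq ->
    [/\ #|x :&: Up| <= s, s - #|x :&: Up| <= b & #|x :&: Up| <= b].
  move=> /setIdP[xA /eqP xM].
  have le_Low : #|x :&: Low| <= b by rewrite -card_Low subset_leq_card ?subsetIr.
  have le_Up : #|x :&: Up| <= b by rewrite -card_Up subset_leq_card ?subsetIr.
  have := A_card x xA; rewrite card_regions xM => xk; split; lia.
(* Only values of [t] realized by chains occur, because the outer regions have
   [b] elements each. *)
have -> : #|Aq| = \sum_(t < s.+1 | (s - t <= b) && (t <= b)) #|[set x in Aq | #|x :&: Up| == t]|.
  rewrite -sum1_card (partition_big (fun x : {set 'I_n} => inord #|x :&: Up| : 'I_s.+1)
     (fun t : 'I_s.+1 => (s - t <= b) && (t <= b))) /=; last first.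
    by move=> x /valid[les ? ?]; rewrite inordK ?ltnS //; apply/andP.
  apply: eq_bigr => t _; rewrite -sum1dep_card; apply: eq_bigl => x.
  case xAq: (x \in Aq) => //=; have [les _ _] := valid x xAq.
  by rewrite -val_eqE /= inordK.
rewrite big_distrr /=.
pose steps := [set y : 'I_n | b + q.-1 <= y < n - b].
have -> : \sum_(p in chain_index) #|A :&: O p| =
    \sum_(t < s.+1 | (s - t <= b) && (t <= b))
      \sum_(y in steps) #|A :&: O (t, y)|.
  by rewrite pair_big_dep; apply: eq_big => [[t y]|[t y] _]; rewrite ?inE.
apply: leq_sum => t /andP[st tb].
apply: (@leq_trans (\sum_(y in steps) #|[set x in Aq | #|x :&: Up| == t]|)).
  rewrite sum_nat_const card_ord_interval ?leq_subr // leq_mul2r; apply/orP; right; lia.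
apply: leq_sum => y yP; apply/subset_leq_card/subsetP => x /setIdP[/setIdP[xA /eqP xM] /eqP xU].
have pJ : (t, y) \in chain_index by move: yP; rewrite !inE /= st tb.
have [cL cM cU] := chain_regions pJ.
rewrite in_setI xA inE; apply/eqP/profile_regions; rewrite ?cM ?cU //.
by rewrite card_chain // A_card.
Qed.
End Chains.

(** * Counting a narrow family *)

(** A [(k-1)]-set extends to at most one member of [A], since two extensions
    by one element differ by an exchange.  This takes care of the members
    without middle elements, which no chain meets. *)
Lemma narrow_subsets (R : realDomainType) n k (F : {set 'I_n} -> R) (A : {set {set 'I_n}}) (W : {set 'I_n}) :
    exchange_increasing k F -> narrow k F A -> 0 < k ->
  k * #|[set x in A | x \subset W]| <= 'C(#|W|, k.-1).
Proof.
move=> F_exch [A_card A_lt] k_gt0; set AW := [set x in A | _].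
pose pairs := [set p : {set 'I_n} * 'I_n | (p.1 \in AW) && (p.2 \in p.1)].
have <- : #|pairs| = k * #|AW|.
  rewrite -sum1dep_card -(pair_big_dep (mem AW) (fun x i => i \in x) (fun _ _ => 1)) /=.
  rewrite mulnC -sum_nat_const; apply: eq_bigr => x /setIdP[xA _].
  by rewrite sum1_card A_card.
rewrite -cards_draws -(card_in_imset (f := fun p : {set 'I_n} * 'I_n => p.1 :\ p.2)).
  apply/subset_leq_card/subsetP => _ /imsetP[[x i] /setIdP[/setIdP[/= xA xW] ix] ->].
  rewrite inE (subset_trans (subD1set _ _) xW) /=.
  by have := A_card x xA; rewrite (cardsD1 i) ix => <-.
move=> [x i] [y j] /setIdP[/setIdP[/= xA _] ix] /setIdP[/setIdP[/= yA _] jy] eq_xy.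
have far (z z' : {set 'I_n}) (e e' : 'I_n) : z \in A -> z' \in A -> e \in z -> e' \in z' ->
    z :\ e = z' :\ e' -> ~~ (e < e').
  move=> zA z'A ez e'z' eq_z; apply/negP => lt_e.
  have e'z : e' \notin z.
    apply: contraFN (setD11 e' z') => e'z.
    by rewrite -eq_z in_setD1 e'z andbT; apply: contraTneq lt_e => ->; rewrite ltnn.
  have := F_exch z e e' (A_card _ zA) ez e'z lt_e.
  by rewrite eq_z setD1K // leNgt A_lt.
have eq_ij : i = j.
  apply/val_inj/eqP; rewrite eqn_leq leqNgt (far _ _ _ _ yA xA jy ix (esym eq_xy)).
  by rewrite leqNgt (far _ _ _ _ xA yA ix jy eq_xy).
by move: ix jy; rewrite eq_ij in eq_xy * => jx jy; rewrite -(setD1K jx) eq_xy setD1K.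
Qed.

Section Narrow.
Variables (R : rcfType) (n k b : nat) (F : {set 'I_n} -> R) (A : {set {set 'I_n}}).
Hypotheses (le_2bn : b.*2 <= n) (F_exch : exchange_increasing k F) (A_narrow : narrow k F A).

Let Mid := [set i : 'I_n | b <= i < n - b].
Let m := n - b.*2.

(** Multiplying the LYM bound by [q + 1] and using
    [(q + 1) C(m, q + 1) = (m - q) C(m, q)] removes the number [m - q] of
    steps of a sweep, which may be small. *)
Lemma middle_bound_sqr s q : k = s + q.+1 -> b.+1 <= 2 * (b.*2 - s).+1 ->
  s.+1 * (q.+1 * #|[set x in A | #|x :&: Mid| == q.+1]|) ^ 2 <= 32 * ('C(m, q) * 'C(b.*2, s)) ^ 2.
Proof.
move=> k_eq le_sb; set a := #|_|.
have [le_mq|lt_qm] := leqP m q.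
  (* The middle region has only [m] elements. *)
  suff -> : a = 0 by rewrite muln0 exp0n // muln0.
  apply/eqP; rewrite cards_eq0; apply/eqP/setP => x; rewrite !inE; apply/negP => /andP[_ /eqP xM].
  have := subset_leq_card (subsetIr x Mid); rewrite xM card_Mid // -/m; lia.
have diag := mul_bin_left m q.
rewrite -(@leq_pmul2l ((m - q) ^ 2)); last by rewrite expn_gt0 subn_gt0 lt_qm.
have -> : (m - q) ^ 2 * (32 * ('C(m, q) * 'C(b.*2, s)) ^ 2) =
    q.+1 ^ 2 * (32 * ('C(m, q.+1) * 'C(b.*2, s)) ^ 2).
  transitivity (32 * ((m - q) * 'C(m, q) * 'C(b.*2, s)) ^ 2); first by ring.
  by rewrite -diag; ring.
have -> : (m - q) ^ 2 * (s.+1 * (q.+1 * a) ^ 2) = q.+1 ^ 2 * (s.+1 * ((m - q) * a) ^ 2) by ring.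
rewrite leq_mul2l; apply/orP; right; rewrite leqNgt; apply/negP => too_big.
have a_gt0 : 0 < (m - q) * a.
  by rewrite lt0n; apply: contraTneq too_big => ->; rewrite exp0n // muln0 ltn0.
have : (m - q) * a <= ((m - q) * a).-1; last by lia.
apply: (middle_bound le_2bn F_exch A_narrow k_eq) => // t ts tb stb.
rewrite -ltnS prednK // ltnNge; apply/negP => le_a.
move: too_big; rewrite ltnNge => /negP[].
apply: (@leq_trans (s.+1 * ('C(b, s - t) * 'C(m, q.+1) * 'C(b, t)) ^ 2)).
  by rewrite leq_mul2l leq_exp2r // le_a orbT.
have -> : s.+1 * ('C(b, s - t) * 'C(m, q.+1) * 'C(b, t)) ^ 2 =
  'C(m, q.+1) ^ 2 * (s.+1 * ('C(b, t) * 'C(b, s - t)) ^ 2) by ring.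
have -> : 32 * ('C(m, q.+1) * 'C(b.*2, s)) ^ 2 = 'C(m, q.+1) ^ 2 * (32 * 'C(b.*2, s) ^ 2) by ring.
by rewrite leq_mul2l hypergeom_upper // orbT.
Qed.
End Narrow.

Section Assembly.
Local Open Scope ring_scope.

(** The hypothesis says [y <= 6 z / sqrt d], and [2 / sqrt d <= l / d + 1 / l]
    because [(l / d + 1 / l)^2 = 4 / d + (l / d - 1 / l)^2].  Little is lost when
    [l] is close to [sqrt d]. *)
Lemma ler_amgm (R : realFieldType) (y z d l : R) : 0 <= z -> 0 < d -> 0 < l ->
  d * y ^+ 2 <= 36 * z ^+ 2 -> y <= 3 * z * (l / d + l^-1).
Proof.
move=> z_ge0 d_gt0 l_gt0 le_y.
have r_ge0 : 0 <= 3 * z * (l / d + l^-1).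
  by rewrite !mulr_ge0 // addr_ge0 ?invr_ge0 ?divr_ge0 // ltW.
have [y_le0|y_gt0] := leP y 0; first exact: le_trans r_ge0.
rewrite -(@ler_pXn2r _ 2) ?nnegrE ?(ltW y_gt0) // -(ler_pM2l d_gt0) (le_trans le_y) //.
have -> : d * (3 * z * (l / d + l^-1)) ^+ 2 =
    36 * z ^+ 2 + 9 * d * (z * (l / d - l^-1)) ^+ 2.
  by field; rewrite !gt_eqF.
by rewrite lerDl mulr_ge0 ?sqr_ge0 // mulr_ge0 // ltW.
Qed.

Lemma Vandermonde_inner m' l k : (0 < k)%N ->
  (\sum_(q < k) 'C(m', q.+1) * 'C(l, k - q) <= 'C(m' + l, k.+1))%N.
Proof.
move=> k_gt0; rewrite -binomial.Vandermonde big_ord_recl big_ord_recr /=.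
apply: leq_trans (leq_addl _ _); apply: leq_trans (leq_addr _ _).
by apply: leq_sum => q _; rewrite /bump /= add1n subSS.
Qed.

Lemma Vandermonde_tail m' l k :
  (\sum_(q < k) 'C(m', q.+1) * 'C(l, k - q.+1) <= 'C(m' + l, k))%N.
Proof.
rewrite -binomial.Vandermonde big_ord_recl /=; apply: leq_trans (leq_addl _ _).
by apply: leq_sum => q _; rewrite /bump /= add1n.
Qed.

(** Here [s + 1] is typically of the order of [k], hence the choice
    [l = sqrt k] in [ler_amgm].  The factors [1 / (q + 1)] and [1 / (s + 1)] are
    absorbed by passing from [m] and [2b] to [m + 1] and [2b + 1], after which
    the sums over [q] are Vandermonde convolutions. *)
Lemma narrow_bound (R : rcfType) n k (F : {set 'I_n} -> R) (A : {set {set 'I_n}}) :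
    exchange_increasing k F -> narrow k F A -> (0 < k)%N -> (k.*2 <= n)%N ->
  #|A|%:R * n%:R * Num.sqrt k%:R <= 162 * 'C(n, k)%:R :> R.
Proof.
move=> F_exch A_narrow k_gt0 le_2kn; have [A_card _] := A_narrow.
pose b := (n %/ 3)%N; pose m := (n - b.*2)%N.
have le_2bn : (b.*2 <= n)%N by rewrite /b; lia.
pose Mid := [set i : 'I_n | (b <= i < n - b)%N].
pose a q := #|[set x in A | #|x :&: Mid| == q]|.
have A_split : #|A| = (a 0 + \sum_(q < k) a q.+1)%N.
  rewrite -sum1_card (partition_big (fun x : {set 'I_n} => inord #|x :&: Mid| : 'I_k.+1) predT) //=.
  transitivity (\sum_(q < k.+1) a q)%N; last by rewrite big_ord_recl.
  apply: eq_bigr => q _; rewrite /a -sum1dep_card; apply: eq_bigl => x.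
  case xA: (x \in A) => //=; rewrite -val_eqE /= inordK // ltnS -(A_card _ xA).
  by rewrite subset_leq_card ?subsetIl.
set l : R := Num.sqrt k%:R.
have l_sqr : l * l = k%:R by rewrite -expr2 sqr_sqrtr.
have l_ge1 : 1 <= l by rewrite -[leLHS]sqrtr1 ler_sqrt ?ler1n // ltr0n.
have l_gt0 : 0 < l by apply: lt_le_trans l_ge1.
pose c1 := 'C(n.+1, k); pose c2 := 'C(n.+2, k.+1).
have mb1 : (m.+1 + b.*2 = n.+1)%N by rewrite addSn subnK.
have mb2 : (m.+1 + b.*2.+1 = n.+2)%N by rewrite addnS mb1.
have V1 := Vandermonde_inner m.+1 b.*2.+1 k_gt0; rewrite mb2 -/c2 in V1.
have V2 := Vandermonde_tail m.+1 b.*2 k; rewrite mb1 -/c1 in V2.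
have a0_le : (m.+1 * b.*2.+1 * a 0 <= c2)%N.
  have diag := mul_bin_diag b.*2.+1 k.-1; rewrite succnK prednK // in diag.
  have A0 : (k * a 0 <= 'C(b.*2, k.-1))%N.
    apply: leq_trans (_ : (k * #|[set x in A | x \subset ~: Mid]| <= _)%N).
      rewrite leq_mul2l; apply/orP; right; apply/subset_leq_card/subsetP => x.
      by case/setIdP => xA x0; rewrite inE xA -disjoints_subset -setI_eq0 -cards_eq0.
    apply: leq_trans (narrow_subsets _ F_exch A_narrow k_gt0) _.
    by rewrite cardsCs setCK card_ord card_Mid // -/m subKn.
  have le1 : (b.*2.+1 * a 0 <= 'C(b.*2.+1, k))%N.
    by rewrite -(leq_pmul2l k_gt0) -diag mulnCA leq_mul2l A0 orbT.
  apply: leq_trans V1; rewrite -mulnA.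
  rewrite (bigD1 (Ordinal k_gt0)) //= subn0 bin1.
  by rewrite (leq_trans _ (leq_addr _ _)) // leq_mul2l le1 orbT.
have aq_le q : (q < k)%N -> m.+1%:R * b.*2.+1%:R * (a q.+1)%:R <=
    3 * l * ('C(m.+1, q.+1) * 'C(b.*2.+1, k - q))%:R
    + 3 * b.*2.+1%:R / l * ('C(m.+1, q.+1) * 'C(b.*2, k - q.+1))%:R :> R.
  move=> lt_qk; pose s := (k - q.+1)%N.
  have k_eq : k = (s + q.+1)%N by rewrite subnK.
  have le_sb : (b.+1 <= 2 * (b.*2 - s).+1)%N by rewrite /s /b; lia.
  have sqr := middle_bound_sqr le_2bn F_exch A_narrow k_eq le_sb.
  rewrite -/Mid -/m -/(a _) in sqr.
  have : q.+1%:R * (a q.+1)%:R <= 3 * ('C(m, q) * 'C(b.*2, s))%:R * (l / s.+1%:R + l^-1) :> R.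
    apply: ler_amgm => //; rewrite -!natrM -!natrX -!natrM ler_nat (leq_trans sqr) //.
    by rewrite leq_mul2r orbT.
  have q1_gt0 : 0 < q.+1%:R :> R by rewrite ltr0n.
  have e1 : m.+1%:R * 'C(m, q)%:R = q.+1%:R * 'C(m.+1, q.+1)%:R :> R.
    by rewrite -!natrM -mul_bin_diag.
  have e2 : b.*2.+1%:R * 'C(b.*2, s)%:R = s.+1%:R * 'C(b.*2.+1, s.+1)%:R :> R.
    by rewrite -!natrM -mul_bin_diag.
  rewrite (_ : (k - q)%N = s.+1); last by rewrite /s; lia.
  have s1_neq0 : s.+1%:R != 0 :> R by rewrite pnatr_eq0.
  have mb_ge0 : 0 <= m.+1%:R * b.*2.+1%:R :> R by rewrite mulr_ge0.
  move/(ler_wpM2l mb_ge0) => le_mean; rewrite -(ler_pM2l q1_gt0).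
  rewrite mulrCA in le_mean; apply: le_trans le_mean _.
  have l_neq0 : l != 0 by rewrite gt_eqF.
  rewrite le_eqVlt; apply/orP; left; apply/eqP; rewrite !natrM -/s.
  move: e1 e2 s1_neq0.
  move: (m.+1%:R) (b.*2.+1%:R) (q.+1%:R) (s.+1%:R) => M B Q S.
  move: ('C(m, q)%:R) ('C(b.*2, s)%:R) ('C(m.+1, q.+1)%:R) ('C(b.*2.+1, s.+1)%:R).
  move=> C1 C2 C3 C4 e1 e2 S_neq0.
  transitivity (3 * (M * C1) * ((B * C2) * (l / S) + B / l * C2)).
    by field; rewrite S_neq0 l_neq0.
  by rewrite e1 e2; field; rewrite S_neq0 l_neq0.
pose M : R := m.+1%:R; pose B : R := b.*2.+1%:R.
have M_gt0 : 0 < M by rewrite ltr0n.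
have B_gt0 : 0 < B by rewrite ltr0n.
have A_le : M * B * #|A|%:R <= 4 * l * c2%:R + 3 * B / l * c1%:R.
  rewrite A_split natrD mulrDr natr_sum mulr_sumr.
  apply: (@le_trans _ _ (l * c2%:R + (3 * l * c2%:R + 3 * B / l * c1%:R))); last first.
    by rewrite addrA lerD2r le_eqVlt; apply/orP; left; apply/eqP; ring.
  apply: lerD.
    apply: (@le_trans _ _ c2%:R); first by rewrite -!natrM ler_nat.
    by rewrite ler_peMl.
  apply: (@le_trans _ _ (\sum_(q < k) (3 * l * ('C(m.+1, q.+1) * 'C(b.*2.+1, k - q))%:R
    + 3 * B / l * ('C(m.+1, q.+1) * 'C(b.*2, k - q.+1))%:R))).
    by apply: ler_sum => q _; apply: aq_le.
  rewrite big_split -!mulr_sumr -!natr_sum; apply: lerD; rewrite ler_wpM2l ?ler_nat //.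
    by rewrite mulr_ge0 // ltW.
  by rewrite divr_ge0 ?mulr_ge0 // ltW.
pose N := 'C(n, k).
have c1_le : (c1 <= 2 * N)%N.
  have := mul_bin_down n.+1 k; rewrite succnK -/c1 -/N => e.
  have pos : (0 < n.+1 - k)%N by lia.
  by rewrite -(leq_pmul2l pos) -e mulnCA mulnA leq_mul2r; apply/orP; right; lia.
have c2_le : (k * c2 <= 4 * n * N)%N.
  have := mul_bin_diag n.+2 k; rewrite succnK -/c1 -/c2 => e.
  by nia.
have nM : (n <= 3 * m.+1)%N by rewrite /m /b; lia.
have nB : (n <= 3 * b.*2.+1)%N by rewrite /b; lia.
have MB_gt0 : 0 < M * B by rewrite mulr_gt0.
rewrite -(ler_pM2l MB_gt0).
apply: (@le_trans _ _ (n%:R * (4 * (k * c2)%:R + 3 * B * c1%:R))).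
  have := ler_wpM2r (ltW l_gt0) A_le; move/(ler_wpM2l (ler0n R n)) => h.
  apply: le_trans (le_trans _ h) _; rewrite le_eqVlt; apply/orP; left; apply/eqP.
    by ring.
  by rewrite natrM -l_sqr; field; rewrite gt_eqF.
rewrite /M /B -!natrM -!natrD -!natrM ler_nat.
nia.
Qed.
End Assembly.

(** * From narrow families to intervals *)

Section Intervals.
Local Open Scope ring_scope.
Variables (R : realType) (n k : nat).

(** The sets with [F x] in a half-open unit interval form a narrow family. *)
Lemma interval_bound_small (F : {set 'I_n} -> R) (a c : R) :
    exchange_increasing k F -> (0 < k)%N -> (k.*2 <= n)%N -> a <= c ->
  #|[set x : {set 'I_n} | (#|x| == k) && (a <= F x <= c)]|%:R * n%:R * Num.sqrt k%:R
    <= 162 * 'C(n, k)%:R * (1 + (c - a)).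
Proof.
move=> F_exch k_gt0 le_2kn le_ac; set A := [set x | _].
pose j x := Num.truncn (F x - a).
have jP x : x \in A -> (j x)%:R <= F x - a < (j x).+1%:R.
  by rewrite inE => /and3P[_ aF _]; rewrite truncn_itv // subr_ge0.
pose M := (Num.truncn (c - a)).+1.
have M_le : M%:R <= 1 + (c - a).
  by rewrite /M -addn1 natrD addrC lerD2l truncn_le // subr_ge0.
have -> : #|A| = (\sum_(i < M) #|[set x in A | j x == i]|)%N.
  rewrite -sum1_card (partition_big (fun x : {set 'I_n} => inord (j x) : 'I_M) predT) //=.
  apply: eq_bigr => i _; rewrite -sum1dep_card; apply: eq_bigl => x.
  case xA: (x \in A) => //=; rewrite -val_eqE /= inordK // ltnS.
  have := xA; rewrite inE => /and3P[_ _ Fc].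
  by apply: le_truncn; rewrite lerD2r.
apply: le_trans (_ : M%:R * (162 * 'C(n, k)%:R) <= _); last first.
  by rewrite mulrC ler_wpM2l // mulr_ge0.
rewrite -mulrA natr_sum mulr_suml [M%:R * _]mulr_natl -[X in _ <= _ *+ X]card_ord -sumr_const.
apply: ler_sum => i _; rewrite mulrA; apply: narrow_bound F_exch _ k_gt0 le_2kn.
split=> [x|x y] /setIdP[xA /eqP xi]; first by move: xA; rewrite inE => /andP[/eqP].
move=> /setIdP[yA /eqP yi]; have := jP x xA; have := jP y yA; rewrite xi yi -natr1; lra.
Qed.

End Intervals.

(** Complementing the sets and negating [F] exchanges [k] and [n - k], so the
    smaller of the two may be taken for [k]. *)
Lemma interval_bound (R : realType) n k (F : {set 'I_n} -> R) (a c : R) :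
    exchange_increasing k F -> 0 < k < n -> (a <= c)%R ->
  (#|[set x : {set 'I_n} | (#|x| == k) && (a <= F x <= c)]|%:R * n%:R
    * Num.sqrt (minn (n - k) k)%:R <= 162 * 'C(n, k)%:R * (1 + (c - a)))%R.
Proof.
move=> F_exch /andP[k_gt0 lt_kn] le_ac.
have [le_2kn|lt_n2k] := leqP k.*2 n.
  by rewrite (minn_idPr _); [apply: interval_bound_small|lia].
rewrite (minn_idPl _); last by lia.
pose F' x : R := (- F (~: x))%R.
have F'_exch : exchange_increasing (n - k) F'.
  move=> x i j xk ix jx lt_ij; rewrite /F' /=.
  set y := ~: (j |: x :\ i).
  have iy : i \in y by rewrite !inE eqxx /= orbF; apply: contraTneq lt_ij => ->; rewrite ltnn.
  have jy : j \notin y by rewrite !inE eqxx.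
  have eq_x : ~: x = j |: y :\ i.
    apply/setP => e; rewrite !inE; case: (eqVneq e j) => [->|] /=; first by rewrite jx.
    by case: (eqVneq e i) => [->|] //=; rewrite ix.
  have card_y : #|y| = k.
    by rewrite cardsCs setCK card_exchange // xk card_ord subKn // ltnW.
  rewrite eq_x; have := F_exch y i j card_y iy jy lt_ij.
  lra.
have := @interval_bound_small R n (n - k) F' (- c)%R (- a)%R F'_exch.
rewrite subn_gt0 lt_kn bin_sub ?(ltnW lt_kn) // lerN2 => /(_ isT _ le_ac).
rewrite opprK [X in (1 + X)%R]addrC => /(_ _)/le_trans h.
rewrite -(card_imset _ (inv_inj (@setCK _))).
rewrite (_ : _ @: _ = [set x : {set 'I_n} | (#|x| == (n - k)%N) && (- c <= F' x <= - a)%R]).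
  by apply: h; first lia.
apply/setP => x; rewrite -[x]setCK mem_imset; last exact: inv_inj (@setCK _).
rewrite !inE /F' setCK !lerN2 [(a <= _)%R && _]andbC; congr (_ && _).
by have := cardsC x; rewrite card_ord; lia.
Qed.

(** * Permutations with prescribed positions of the high indices *)

(** An upward exchange of [i] for [j] is a sequence of exchanges of neighbours:
    if [i + 1] is occupied, its occupant first goes on to [j] and [i] then takes
    its place; otherwise [i] moves to [i + 1] and continues from there. *)
Lemma adjacent_exchange_increasing (R : realDomainType) n k (F : {set 'I_n} -> R) :
    (forall (x : {set 'I_n}) (i j : 'I_n), #|x| = k -> i \in x -> j \notin x ->
       j = i.+1 :> nat -> (F x + 1 <= F (j |: x :\ i))%R) ->
  exchange_increasing k F.
Proof.
move=> F_adj x i j; have [d] := ubnP (j - i).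
elim: d => // d IHd in x i j * => lt_d xk ix jx lt_ij.
have [ji|neq_ji] := eqVneq (j : nat) i.+1; first exact: F_adj.
have lt_en : i.+1 < n by have := ltn_ord j; lia.
pose e := Ordinal lt_en.
have neq_ij : i != j by rewrite -val_eqE /=; lia.
have neq_ie : i != e by rewrite -val_eqE /=; lia.
have neq_je : j != e by rewrite -val_eqE /=; lia.
have [ex|ex] := boolP (e \in x).
  have step1 := IHd x e j ltac:(rewrite /=; lia) xk ex jx ltac:(rewrite /=; lia).
  set y := j |: x :\ e in step1.
  have iy : i \in y by rewrite !inE ix neq_ie orbT.
  have ey : e \notin y by rewrite !inE eqxx /= eq_sym (negPf neq_je).
  have step2 := F_adj y i e ltac:(by rewrite card_exchange) iy ey erefl.
  rewrite (_ : e |: y :\ i = j |: x :\ i) in step2; first lra.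
  apply/setP => u; rewrite !inE; case: (eqVneq u e) => [->|_] /=; last first.
    by case: (eqVneq u j) => [->|_] //=; rewrite eq_sym neq_ij.
  by rewrite ex [e == i]eq_sym neq_ie orbT.
have step1 := F_adj x i e xk ix ex erefl.
set y := e |: x :\ i in step1.
have ey : e \in y by rewrite !inE eqxx.
have jy : j \notin y by rewrite !inE (negPf jx) (negPf neq_je) andbF.
have step2 := IHd y e j ltac:(rewrite /=; lia) ltac:(by rewrite card_exchange) ey jy ltac:(rewrite /=; lia).
rewrite (_ : j |: y :\ e = j |: x :\ i) in step2; first lra.
apply/setP => u; rewrite !inE; case: (eqVneq u e) => [->|_] //=.
by rewrite (negPf ex) andbF.
Qed.

Section Placement.
Variables (n l : nat).
Hypothesis le_ln : l <= n.
Implicit Types (x : {set 'I_n}) (p q : 'I_n).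

Let high (i : 'I_n) := l <= i.

Definition same_side x p := [set q | (q \in x) == (p \in x)].

Definition rank x p := #|[set q in same_side x p | q < p]|.

Definition place_index x p := (if p \in x then l else 0) + rank x p.

(** The permutation that puts the indices [>= l] in increasing order at the
    positions in [x] and the indices [< l] in increasing order elsewhere, when
    [x] has [n - l] elements.  The default value occurs for other sizes only. *)
Definition place x : 'S_n :=
  odflt 1%g [pick g : 'S_n | [forall p, g p == place_index x p :> nat]].

Lemma same_sideE x p : same_side x p = if p \in x then x else ~: x.
Proof. by apply/setP => q; rewrite inE; case: ifP => _; rewrite ?inE; case: (q \in x). Qed.

Lemma rank_lt x p : rank x p < #|same_side x p|.
Proof.
apply: (@leq_trans #|[set q in same_side x p | q < p] :|: [set p]|); last first.
  by apply/subset_leq_card/subsetP => q; rewrite !inE => /orP[/andP[]|/eqP->].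
by rewrite setUC cardsU1 !inE ltnn andbF.
Qed.

Lemma placeE x p : #|x| = n - l -> place x p = place_index x p :> nat.
Proof.
move=> xk.
have card_xC : #|~: x| = l by have := cardsC x; rewrite card_ord xk; lia.
have index_lt q : place_index x q < n.
  have := rank_lt x q; rewrite /place_index same_sideE.
  by case: ifP => _; rewrite ?xk ?card_xC; lia.
have index_inj : injective (fun q => Ordinal (index_lt q)).
  have rank_mono (q r : 'I_n) : (q \in x) = (r \in x) -> q < r -> rank x q < rank x r.
    move=> qr lt_qr; rewrite /rank (_ : same_side x r = same_side x q); last first.
      by apply/setP => e; rewrite !inE qr.
    apply: proper_card; apply/properP; split.
      by apply/subsetP => e; rewrite !inE => /andP[-> /ltn_trans->].
    by exists q; rewrite !inE ?eqxx ?ltnn ?andbF.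
  suff lt_index (q r : 'I_n) : q < r -> place_index x q != place_index x r.
    move=> q r /(congr1 val) /= eq_qr; apply/val_inj.
    have [lt_qr|lt_rq|//] := ltngtP q r.
      by have := lt_index _ _ lt_qr; rewrite eq_qr eqxx.
    by have := lt_index _ _ lt_rq; rewrite eq_qr eqxx.
  move=> lt_qr; have := rank_lt x q; have := rank_lt x r.
  rewrite /place_index !same_sideE.
  case xq: (q \in x); case xr: (r \in x); rewrite ?xk ?card_xC; try lia.
    by have := rank_mono q r; rewrite xq xr => /(_ erefl lt_qr); lia.
  by have := rank_mono q r; rewrite xq xr => /(_ erefl lt_qr); lia.
rewrite /place; case: pickP => [g /forallP/(_ p)/eqP //|/(_ (perm index_inj))].
by case/forallP => q; rewrite permE.
Qed.

Lemma place_high x p : #|x| = n - l -> (l <= place x p) = (p \in x).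
Proof.
move=> xk; rewrite placeE //; have := rank_lt x p; rewrite /place_index same_sideE.
have card_xC : #|~: x| = l by have := cardsC x; rewrite card_ord xk; lia.
by case: ifP => _; rewrite ?card_xC; lia.
Qed.

(** Exchanging two neighbouring positions of different kind leaves the order
    inside both kinds unchanged. *)
Lemma place_exchange x i j : #|x| = n - l -> i \in x -> j \notin x -> j = i.+1 :> nat ->
  forall p, place (j |: x :\ i) p = place x (tperm i j p).
Proof.
move=> xk ix jx ji p; set y := j |: x :\ i.
have mem_y q : (q \in y) = (tperm i j q \in x).
  rewrite !inE; case: tpermP => [->|->|/eqP/negPf-> /eqP/negPf->] //.
  - by rewrite (negPf jx) eqxx /= orbF; apply/negP => /eqP ij; move: ji; rewrite ij; lia.
  - by rewrite eqxx ix.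
have yk : #|y| = n - l by rewrite card_exchange.
clearbody y; apply/val_inj; rewrite /= !placeE // /place_index mem_y; congr (_ + _).
rewrite /rank -[RHS](card_imset _ (@perm_inj _ (tperm i j))); congr #|pred_of_set _|.
apply/setP => q; rewrite -[q in RHS](tpermK i j) mem_imset; last exact: perm_inj.
rewrite !inE !mem_y; case: eqP => //= eq_side.
move: eq_side; case: (tpermP i j p) => [->|->|/eqP pi /eqP pj];
  case: (tpermP i j q) => [->|->|/eqP qi /eqP qj]; rewrite ?ix ?(negPf jx) ?ltnn //=.
- by move=> _; move: qi qj; rewrite -!val_eqE /=; lia.
- by move=> _; move: qi qj; rewrite -!val_eqE /=; lia.
- by move=> _; move: pi pj; rewrite -!val_eqE /=; lia.
- by move=> _; move: pi pj; rewrite -!val_eqE /=; lia.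
Qed.

Lemma card_high_positions (g : 'S_n) : #|[set p | l <= g p]| = n - l.
Proof.
rewrite -(card_imset _ (@perm_inj _ g)).
rewrite (_ : _ @: _ = [set i : 'I_n | l <= i < n]) ?card_ord_interval //.
apply/setP => i; rewrite -[i](permKV g) mem_imset; last exact: perm_inj.
by rewrite !inE permKV ltn_ord andbT.
Qed.

(** Every permutation factors uniquely as an order-preserving placement
    followed by a permutation that keeps low and high indices apart. *)
Lemma count_perms (P : pred 'S_n) :
  #|[set g | P g]| =
  \sum_(h in region_perms high) #|[set x : {set 'I_n} | (#|x| == n - l) && P (place x * h)%g]|.
Proof.
rewrite -sum1dep_card (partition_big (fun g : 'S_n => [set p | l <= g p])
  (fun x : {set 'I_n} => #|x| == n - l)) /=; last by move=> g _; rewrite card_high_positions.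
rewrite (eq_bigr (fun x => \sum_(h in region_perms high) (P (place x * h)%g : nat))).
  rewrite exchange_big; apply: eq_bigr => h _.
  by rewrite -sum1dep_card big_mkcondr.
move=> x /eqP xk; rewrite (reindex_inj (mulgI (place x))) -big_mkcondr.
apply: eq_bigl => h; rewrite andbC; congr (_ && _).
apply/eqP/region_permP => [/setP eq_x i|hP].
  have := eq_x (((place x)^-1)%g i); rewrite inE permM permKV.
  by rewrite -(place_high _ xk) permKV.
by apply/setP => p; rewrite inE permM -(place_high _ xk); apply: hP.
Qed.
End Placement.

(** * The random permutation sum *)

Section Permutations.
Local Open Scope ring_scope.
Variable R : realType.

Definition perm_sum n (w v : 'I_n -> R) (g : 'S_n) : R := \sum_p w (g p) * v p.

(** For a fixed [h] keeping low and high indices apart, the sum is a function of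
    the set [x] of positions of the high indices, and exchanging neighbouring
    positions of a high and a low index swaps two factors whose differences are
    at least [delta] and [gap].  Divided by [gap * delta] it is therefore
    [exchange_increasing]. *)
Lemma two_blocks_bound n l (w v : 'I_n -> R) (delta gap a c : R) :
    (0 < l < n)%N -> 0 < delta -> 0 < gap -> a <= c ->
    (forall i j : 'I_n, (i < l)%N -> (l <= j)%N -> w i + delta <= w j) ->
    (forall i j : 'I_n, (i < j)%N -> v i + gap <= v j) ->
  #|[set g | a <= perm_sum w v g <= c]|%:R * n%:R * Num.sqrt (minn l (n - l))%:R
    <= 162 * n`!%:R * (1 + (c - a) / (gap * delta)).
Proof.
move=> /andP[l_gt0 lt_ln] delta_gt0 gap_gt0 le_ac w_gap v_gap.
have le_ln := ltnW lt_ln; pose k := (n - l)%N.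
have gd_gt0 : 0 < gap * delta by rewrite mulr_gt0.
rewrite (count_perms le_ln); set H := region_perms _.
have card_fact : n`! = (#|H| * 'C(n, k))%N.
  have := count_perms le_ln predT; rewrite cardsT card_Sn => ->.
  rewrite -sum_nat_const; apply: eq_bigr => h _.
  rewrite -[n in 'C(n, _)]card_ord -card_draws; apply: eq_card => x.
  by rewrite !inE andbT.
rewrite card_fact natrM; set Y := 1 + _.
rewrite (_ : 162 * (#|H|%:R * 'C(n, k)%:R) * Y = #|H|%:R * (162 * 'C(n, k)%:R * Y)); last by ring.
rewrite [#|H|%:R * _]mulr_natl natr_sum !mulr_suml -sumr_const; apply: ler_sum => h hH.
pose F x := perm_sum w v (place l x * h)%g / (gap * delta).
have F_exch : exchange_increasing k F.
  apply: adjacent_exchange_increasing => x i j xk ix jx ji.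
  have neq_ij : i != j by rewrite -val_eqE /=; lia.
  rewrite /F -[1](@divff _ (gap * delta)) ?gt_eqF // -mulrDl ler_pM2r ?invr_gt0 //.
  rewrite -lerBrDl /perm_sum -sumrB.
  pose W p := w (h (place l x p)).
  have -> : \sum_p (w ((place l (j |: x :\ i) * h)%g p) * v p - w ((place l x * h)%g p) * v p)
      = (W i - W j) * (v j - v i).
    have swap p : (place l (j |: x :\ i) * h)%g (tperm i j p) = h (place l x p).
      by rewrite permM (place_exchange le_ln xk ix jx ji) tpermK.
    rewrite sumrB (reindex_inj (@perm_inj _ (tperm i j))) /= -sumrB.
    rewrite (eq_bigr (fun p => W p * (v (tperm i j p) - v p))); last first.
      by move=> p _; rewrite swap permM mulrBr.
    rewrite (bigD1 i) //= (bigD1 j) 1?eq_sym //= big1 ?addr0 => [|p /andP[pi pj]].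
      by rewrite tpermL tpermR; ring.
    by rewrite tpermD 1?eq_sym // subrr mulr0.
  have hP q : (l <= h q)%N = (l <= q)%N by move/region_permP: hH => /(_ q).
  have W_gap : delta <= W i - W j.
    rewrite lerBrDl; apply: w_gap; last by rewrite hP place_high.
    by rewrite ltnNge hP place_high.
  have v_ij : gap <= v j - v i by rewrite lerBrDl v_gap // ji.
  by rewrite mulrC ler_pM // ltW.
have k_bounds : (0 < k < n)%N by rewrite /k; lia.
have le_scaled : a / (gap * delta) <= c / (gap * delta) by rewrite ler_pM2r ?invr_gt0.
have := interval_bound F_exch k_bounds le_scaled.
rewrite (_ : (n - k)%N = l) ?subKn // -mulrBl; congr (_%:R * _ * _ <= _).
by apply: eq_card => x; rewrite !inE !ler_pM2r ?invr_gt0.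
Qed.

(** Splitting according to the position [p] of one index [j] leaves a uniformly
    random placement of the other indices. *)
Lemma card_delete_index n (j : 'I_n.+1) (P : pred 'S_n.+1) :
  (#|[set g | P g]| <= \sum_p #|[set g' : 'S_n | P (lift_perm p j g')]|)%N.
Proof.
rewrite -sum1dep_card (partition_big (fun g : 'S_n.+1 => (g^-1)%g j) predT) //=.
apply: leq_sum => p _; rewrite sum1dep_card.
apply: leq_trans (leq_imset_card (lift_perm p j) _).
apply/subset_leq_card/subsetP => g; rewrite inE => /andP[gP /eqP gj].
have gp : g p = j by rewrite -gj permKV.
have unlift_g q : {r | g (lift p q) = lift j r}.
  have neq : j != g (lift p q) by rewrite -gp (inj_eq perm_inj) neq_lift.
  by have [r ->] := unlift_some neq; exists r.
pose f q := sval (unlift_g q).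
have fE q : g (lift p q) = lift j (f q) by exact: (svalP (unlift_g q)).
have f_inj : injective f.
  by move=> q r eq_f; apply/(@lift_inj _ p)/(@perm_inj _ g); rewrite !fE eq_f.
have g_lift : g = lift_perm p j (perm f_inj).
  apply/permP => q; case: (unliftP p q) => [r|] ->; last by rewrite lift_perm_id.
  by rewrite lift_perm_lift permE fE.
by apply/imsetP; exists (perm f_inj); rewrite ?inE -g_lift.
Qed.

(** Induction on the number of indices outside the two blocks.  Given its
    position [p], the index [j = i1], the first one after the low block,
    contributes the constant [w j * v p], which shifts the interval; the bound
    does not depend on the location of the interval, and deleting [j] and [p]
    preserves the hypotheses. *)
Lemma outer_blocks_bound n i1 i2 (w v : 'I_n -> R) (delta gap a c : R) :
    (0 < i1)%N -> (0 < i2)%N -> (i1 + i2 <= n)%N -> 0 < delta -> 0 < gap -> a <= c ->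
    (forall i j : 'I_n, (i < i1)%N -> (n - i2 <= j)%N -> w i + delta <= w j) ->
    (forall i j : 'I_n, (i < j)%N -> v i + gap <= v j) ->
  #|[set g | a <= perm_sum w v g <= c]|%:R * (i1 + i2)%:R * Num.sqrt (minn i1 i2)%:R
    <= 162 * n`!%:R * (1 + (c - a) / (gap * delta)).
Proof.
move=> i1_gt0 i2_gt0 le_n delta_gt0 gap_gt0.
elim: n => [|n IHn] in w v a c le_n * => le_ac w_gap v_gap; first by lia.
have [eq_n|neq_n] := eqVneq (i1 + i2)%N n.+1.
  have i2E : i2 = (n.+1 - i1)%N by lia.
  rewrite eq_n i2E; apply: two_blocks_bound => //; first by lia.
  by move=> i j lt_i le_j; apply: w_gap => //; lia.
have lt_i1 : (i1 < n.+1)%N by lia.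
pose j := Ordinal lt_i1.
have deletion := card_delete_index j (fun g => a <= perm_sum w v g <= c).
have min_ge0 : 0 <= Num.sqrt (minn i1 i2)%:R :> R by exact: sqrtr_ge0.
rewrite -(ler_nat R) in deletion.
have := ler_wpM2r min_ge0 (ler_wpM2r (ler0n R (i1 + i2)) deletion).
move=> /le_trans; apply.
set Y := 1 + _.
rewrite factS natrM (_ : 162 * _ * Y = n.+1%:R * (162 * n`!%:R * Y)); last by ring.
rewrite [n.+1%:R * _]mulr_natl natr_sum !mulr_suml -[X in _ <= _ *+ X]card_ord -[leRHS]sumr_const.
apply: ler_sum => p _.
have sum_lift (g : 'S_n) : perm_sum w v (lift_perm p j g) =
    w j * v p + perm_sum (fun i => w (lift j i)) (fun i => v (lift p i)) g.
  rewrite /perm_sum (bigD1_ord p) //= lift_perm_id; congr (_ + _).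
  by apply: eq_bigr => i _; rewrite lift_perm_lift.
have -> : Y = 1 + ((c - w j * v p) - (a - w j * v p)) / (gap * delta) by rewrite /Y; congr (1 + _ / _); ring.
have le_n' : (i1 + i2 <= n)%N by lia.
have le_ac' : a - w j * v p <= c - w j * v p by rewrite lerD2r.
have w_gap' (i i' : 'I_n) : (i < i1)%N -> (n - i2 <= i')%N -> w (lift j i) + delta <= w (lift j i').
  by move=> lt_i le_i'; apply: w_gap; rewrite /= /bump; lia.
have v_gap' (i i' : 'I_n) : (i < i')%N -> v (lift p i) + gap <= v (lift p i').
  by move=> lt_i; apply: v_gap; rewrite /= /bump; lia.
apply: le_trans (IHn _ _ _ _ le_n' le_ac' w_gap' v_gap').
rewrite le_eqVlt; apply/orP; left; apply/eqP; congr (_%:R * _ * _).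
by apply: eq_card => g; rewrite !inE sum_lift lerBlDl lerBrDl.
Qed.

End Permutations.

Local Open Scope ring_scope.

Lemma Delta_le (R : realType) n (v : 'rV[R]_n) (i j : 'I_n) :
  increasing v -> (i < j)%N -> v 0 i + Delta v <= v 0 j.
Proof.
move=> v_inc lt_ij; rewrite -lerBrDl -[leRHS]ger0_norm ?subr_ge0 ?v_inc ?(ltnW lt_ij) //.
rewrite distrC /Delta; apply: (@ge_bigmin_seq _ _ _ _ _ _ xpredT id) => //.
by apply/imageP; exists (i, j) => //; rewrite inE /= -val_eqE /= ltn_eqF.
Qed.

Lemma entry1_ord (R : realType) n (w : 'rV[R]_n) (i : 'I_n) : entry1 w i.+1 = w 0 i.
Proof.
rewrite /entry1 /= (nth_map i) ?size_enum_ord //.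
by rewrite nth_ord_enum.
Qed.

Theorem theorem1p4 (R : realType) :
  exists C : R, 0 < C /\
    forall (n : nat) (w v : 'rV[R]_n),
      (2 <= n)%N -> increasing w -> increasing v -> 0 < Delta v ->
    forall (a b : R) (i1 i2 : nat),
      a <= b ->
      (1 <= i1 <= n)%N -> (1 <= i2 <= n)%N -> (i1 + i2 <= n)%N ->
      0 < entry1 w (n - i2) - entry1 w i1 ->
      uniform_probability R [set pi : 'S_n | dot (col_perm pi w) v \in `[a, b]]
        <= C * (1 + (b - a) / (Delta v * (entry1 w (n - i2) - entry1 w i1)))
           * (1 / ((i1 + i2)%:R * Num.sqrt (minn i1 i2)%:R : R)).
Proof.
exists 162; split=> // n w v _ w_inc v_inc Delta_gt0 a b i1 i2 le_ab.
move=> /andP[i1_gt0 le_i1] /andP[i2_gt0 le_i2] le_n delta_gt0.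
set delta := entry1 w _ - _ in delta_gt0 *.
have w_gap (i j : 'I_n) : (i < i1)%N -> (n - i2 <= j)%N -> w 0 i + delta <= w 0 j.
  move=> lt_i le_j.
  have low_lt : (i1.-1 < n)%N by lia.
  have high_lt : ((n - i2).-1 < n)%N by lia.
  have low : entry1 w i1 = w 0 (Ordinal low_lt) by rewrite -entry1_ord /= prednK.
  have high : entry1 w (n - i2) = w 0 (Ordinal high_lt).
    by rewrite -entry1_ord /= prednK //; lia.
  have le_low : w 0 i <= w 0 (Ordinal low_lt) by apply: w_inc => /=; lia.
  have le_high : w 0 (Ordinal high_lt) <= w 0 j by apply: w_inc => /=; lia.
  by rewrite /delta low high; lra.
have v_gap (i j : 'I_n) : (i < j)%N -> v 0 i + Delta v <= v 0 j by exact: Delta_le.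
have main := outer_blocks_bound i1_gt0 i2_gt0 le_n delta_gt0 Delta_gt0 le_ab w_gap v_gap.
rewrite /uniform_probability card_Sn.
have -> : [set pi : 'S_n | dot (col_perm pi w) v \in `[a, b]] =
    [set g : 'S_n | a <= perm_sum (w 0) (v 0) g <= b].
  apply/setP => g; rewrite !inE /=.
  suff -> : dot (col_perm g w) v = perm_sum (w 0) (v 0) g by [].
  by apply: eq_bigr => i _; rewrite mxE.
have min_gt0 : 0 < Num.sqrt (minn i1 i2)%:R :> R.
  by rewrite sqrtr_gt0 ltr0n leq_min i1_gt0.
have sum_gt0 : 0 < (i1 + i2)%:R :> R by rewrite ltr0n addn_gt0 i1_gt0.
have fact_gt0R : 0 < n`!%:R :> R by rewrite ltr0n fact_gt0.
rewrite div1r ler_pdivrMr // mulrAC ler_pdivlMr ?mulr_gt0 // mulrA.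
by apply: le_trans main _; rewrite mulrAC.
Qed.
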